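(* Each $\kappa$-Fréchet--Urysohn locally convex space $E$ is $b$-Baire-like. Consequently, $E$ is quasibarrelled.
   Context: A Tychonoff space $X$ is $\kappa$-Fréchet--Urysohn if for any open set $U\subseteq X$ and each $x\in\overline{U}$ there exists a sequence in $U$ converging to $x$. A subset $A$ of a topological vector space $E$ is bornivorous if for every bounded subset $B$ of $E$ there exists $n\in\omega$ such that $B\subseteq nA$. A locally convex space $E$ is $b$-Baire-like if for any increasing sequence $\{A_n\}_{n\in\omega}$ of closed absolutely convex and bornivorous subsets of $E$ covering $E$, there is an $n\in\omega$ such that $A_n$ is a neighborhood of zero. $E$ is quasibarrelled if every closed absolutely convex bornivorous subset of $E$ is a neighborhood of zero. *)

(* Defs.v *)
From HB Require Import structures.
From mathcomp Require Import all_boot all_order all_algebra.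
From mathcomp Require Import complex.
From mathcomp Require Import all_classical all_reals all_analysis.

Set Implicit Arguments.
Unset Strict Implicit.
Unset Printing Implicit Defensive.

Import Order.TTheory GRing.Theory Num.Theory.

Local Open Scope classical_set_scope.
Local Open Scope ring_scope.
Local Open Scope complex_scope.

(* The topology that [tvsType K] puts on the scalars is the one of [K^o],
   induced by the norm, so for [R[i]] it is the usual topology of the complex
   plane. *)
Variant real_or_complex (R : realType) : numFieldType -> Prop :=
  | real_scalars : real_or_complex R R
  | complex_scalars : real_or_complex R R[i].

Definition tychonoff_space (X : topologicalType) : Prop :=
  completely_regular_space X /\ hausdorff_space X.

Definition kappa_frechet_urysohn (X : topologicalType) : Prop :=
  tychonoff_space X /\
  forall (U : set X) (x : X), open U -> closure U x ->
    exists u : nat -> X, (forall n, U (u n)) /\ u @ \oo --> x.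

Section LinearTopology.
Context {K : numFieldType} {E : topologicalLmodType K}.
Implicit Types A B V : set E.

(* In the order of [R[i]], [s < t] with [0 < s] forces [s] and [t] to be real,
   so the dilations below are by positive reals for complex scalars too. *)
Definition tvs_bounded B : Prop :=
  forall V, nbhs 0 V ->
    exists2 s : K, 0 < s & forall t : K, s < t -> B `<=` *:%R t @` V.

Definition bornivorous A : Prop :=
  forall B, tvs_bounded B -> exists n : nat, B `<=` *:%R n%:R @` A.

Definition balanced A : Prop :=
  forall a : K, `|a| <= 1 -> *:%R a @` A `<=` A.

Definition absolutely_convex A : Prop := convex_set A /\ balanced A.

End LinearTopology.

Definition b_baire_like (K : numFieldType) (E : tvsType K) : Prop :=
  forall A : nat -> set E,
    (forall m n, (m <= n)%N -> A m `<=` A n) ->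
    (forall n, [/\ closed (A n), absolutely_convex (A n) & bornivorous (A n)]) ->
    \bigcup_n A n = [set: E] ->
    exists n, nbhs 0 (A n).

Definition quasibarrelled (K : numFieldType) (E : tvsType K) : Prop :=
  forall A : set E,
    closed A -> absolutely_convex A -> bornivorous A -> nbhs 0 A.

(* Main.v *)
Require Import Defs.
From mathcomp Require Import all_boot all_order all_algebra.
From mathcomp Require Import complex.
From mathcomp Require Import all_classical all_reals all_analysis.

(** Both conclusions come from one fact: a closed absolutely convex bornivorous
    set [A] is a neighborhood of zero.  A sequence of such sets is then handled
    by its first term.

    Suppose that [A] is not a neighborhood of zero.  By absolute convexity no
    multiple [n A] has an interior point ([nbhs0_absolutely_convex]), so the
    open sets [E \ n A] are dense.  Fix [z != 0], which exists since otherwise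
    [A = E].  Around each [z_n = z / (n + 1)] choose an open [P n] that is
    disjoint from some open neighborhood [Q n] of zero, and let [U] be the union
    of the sets [P n \ (n + 1) A].  Each [z_n] lies in the closure of [U], and
    [z_n] tends to zero because the scalars are archimedean; so zero lies in the
    closure of [U], and some sequence [u] in [U] converges to zero.

    The range of [u] is bounded ([tvs_bounded_cvg_seq]), hence contained in
    [m A] for some [m].  Since [A] is balanced, [m A] is contained in
    [(n + 1) A] as soon as [m <= n + 1], so every [u k] lies in some [P n] with
    [n < m].  But [u] eventually enters the neighborhood [Q n] of zero for each
    of these finitely many [n], which is absurd. *)

Set Implicit Arguments.
Unset Strict Implicit.
Unset Printing Implicit Defensive.

Import Order.TTheory GRing.Theory Num.Theory.
Import numFieldNormedType.Exports.

Local Open Scope classical_set_scope.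
Local Open Scope ring_scope.

Lemma real_or_complex_invn_lt (R : realType) (K : numFieldType)
    (hK : real_or_complex R K) (e : K) :
  0 < e -> exists n : nat, n.+1%:R^-1 < e.
Proof.
case: hK e => e; first by move=> /ltr_add_invr[n]; rewrite add0r; exists n.
(* A positive complex number is a positive real one. *)
case: e => a b; rewrite ltcE /= => /andP[/eqP -> /ltr_add_invr[n]].
rewrite add0r => na; exists n.
have -> : n.+1%:R^-1 = (real_complex R n.+1%:R^-1) :> R[i]%C.
  by rewrite fmorphV rmorph_nat.
by rewrite ltcR.
Qed.

Section TopologicalModule.
Context {K : numFieldType} {E : topologicalLmodType K}.
Implicit Types (V : set E) (x : E).

Lemma near0_scale V x : nbhs 0 V -> \forall a \near (0 : K^o), V (a *: x).
Proof.
move=> V0; have /= := @scale_continuous K E (0, x) V; rewrite scale0r.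
move=> /(_ V0)[[P Q]/= [P0 Qx] PQV]; apply: filterS P0 => a Pa.
by apply: (PQV (a, x)); split => //; exact: nbhs_singleton Qx.
Qed.

(** Joint continuity of the scaling at [(0, x)] deals with a tail of the
    sequence, and its separate continuity with the finitely many terms before
    that tail. *)
Lemma near0_scale_cvg_seq (u : nat -> E) x V :
  u @ \oo --> x -> nbhs 0 V ->
  \forall a \near (0 : K^o), forall k, V (a *: u k).
Proof.
move=> ux V0; have /= := @scale_continuous K E (0, x) V; rewrite scale0r.
move=> /(_ V0)[[P Q]/= [P0 Qx] PQV].
have [N _ NQ] := ux _ Qx.
have PN : \forall a \near (0 : K^o), forall i : 'I_N, V (a *: u i).
  apply: (filter_forall (f := fun i : 'I_N => [set a : K^o | V (a *: u i)])
    (nbhs_filter _)) => i.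
  exact: near0_scale.
near=> a => k; have [Nk|kN] := leqP N k.
  by apply: (PQV (a, u k)); split => /=; [near: a|exact: NQ].
have aV : forall i : 'I_N, V (a *: u i) by near: a.
exact: (aV (Ordinal kN)).
Unshelve. all: by end_near. Qed.

Lemma tvs_bounded_cvg_seq (u : nat -> E) x :
  u @ \oo --> x -> tvs_bounded (range u).
Proof.
move=> ux V V0; have /nbhs_ballP[e /= e0 eV] := near0_scale_cvg_seq ux V0.
exists e^-1; first by rewrite invr_gt0.
move=> t et _ [k _ <-]; have t0 : 0 < t by apply: lt_trans et; rewrite invr_gt0.
exists (t^-1 *: u k); last by rewrite scalerA divff ?gt_eqF// scale1r.
apply: eV; rewrite -ball_normE /ball_ /= sub0r normrN gtr0_norm ?invr_gt0//.
by rewrite invf_plt ?posrE.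
Qed.

Lemma bornivorous_neq0 (A : set E) : bornivorous A -> A !=set0.
Proof.
move=> /(_ [set 0]) []; last by move=> n /(_ 0 erefl)[y Ay _]; exists y.
move=> V V0; exists 1 => // t _ _ ->; exists 0; last exact: scaler0.
exact: nbhs_singleton.
Qed.

End TopologicalModule.

Section LocallyConvex.
Context {K : numFieldType} {E : tvsType K}.
Implicit Types (A : set E) (x : E).

(** An interior point [x] of [A] makes [(A - x) / 2] a neighborhood of zero, and
    this set is contained in [A] because [- x] belongs to [A]. *)
Lemma nbhs0_absolutely_convex A x :
  absolutely_convex A -> nbhs x A -> nbhs 0 A.
Proof.
move=> [cA bA] Ax; have := nbhsB (- x) Ax; rewrite addNr.
have h0 : (2^-1 : K) != 0 by rewrite invr_eq0 pnatr_eq0.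
move=> /(nbhs0Z h0); apply: filterS => _ [_ [y Ay <-] <-].
have ANx : A (- x).
  apply: (bA (-1)); first by rewrite normrN1.
  by exists x; [exact: nbhs_singleton|rewrite scaleN1r].
have h1 : 0 <= 2^-1 :> K by rewrite invr_ge0 ler0n.
have h2 : 2^-1 <= 1 :> K by rewrite invf_le1 ?ltr0n// ler1n.
have := cA (- x) y (Itv01 h1 h2) (mem_set ANx) (mem_set Ay).
rewrite inE; congr A; rewrite /conv /= scalerDr; congr (_ + _ *: _).
by change (1 - 2^-1 = 2^-1 :> K); rewrite [X in X - _]splitr div1r addrK.
Qed.

(** No multiple [r^-1 A] has an interior point, since scaling by [r] would carry
    it to an interior point of [A]. *)
Lemma nbhs_scale_notin A x (O : set E) (r : K) : r != 0 ->
  absolutely_convex A -> ~ nbhs 0 A -> nbhs x O ->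
  exists2 y, O y & ~ A (r *: y).
Proof.
move=> r0 acA A0 Ox; apply: contrapT => OA; apply: A0.
apply: (@nbhs0_absolutely_convex _ (r *: x)) => //.
have := nbhsZ r0 Ox; apply: filterS => _ [y Oy <-].
by apply: contrapT => nAy; apply: OA; exists y.
Qed.

Lemma closed_scale_openC A (r : K) :
  closed A -> open [set y | ~ A (r *: y)].
Proof.
move=> cA; apply: (@open_comp _ _ ( *:%R r) (~` A)); last exact: closed_openC.
move=> y _; apply: (@continuous_comp _ _ _ (fun y => (r, y) : K^o * E)
  (fun z : K^o * E => z.1 *: z.2)); last exact: scale_continuous.
by apply: (@cvg_pair _ _ _ _ (nbhs (r : K^o))); [exact: cvg_cst|exact: cvg_id].
Qed.

End LocallyConvex.

(** The neighborhood [Q n] of zero is what keeps a null sequence from staying in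
    one single [P n]. *)
Lemma hausdorff_separate_seq0 (X : topologicalType) (o : X) (z : nat -> X) :
  hausdorff_space X -> (forall n, z n != o) ->
  exists P Q : nat -> set X, forall n,
    [/\ open (P n), P n (z n), nbhs o (Q n) & P n `&` Q n = set0].
Proof.
rewrite open_hausdorff => hX zo.
have sep n : exists PQ : set X * set X,
    [/\ open PQ.1, PQ.1 (z n), nbhs o PQ.2 & PQ.1 `&` PQ.2 = set0].
  have [PQ [/set_mem zP /set_mem oQ] [oP oQ' /eqP PQ0]] := hX _ _ (zo n).
  by exists PQ; split => //; exact: open_nbhs_nbhs.
have [PQ PQP] := choice sep.
by exists (fun n => (PQ n).1), (fun n => (PQ n).2).
Qed.

Lemma balanced_scale_le (K : numFieldType) (E : tvsType K) (A : set E)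
    (m n : nat) (a : E) :
  balanced A -> (m <= n.+1)%N -> A a -> A (n.+1%:R^-1 *: (m%:R *: a)).
Proof.
move=> bA mn Aa; apply: (bA (n.+1%:R^-1 * m%:R)).
  rewrite ger0_norm ?mulr_ge0 ?invr_ge0 ?ler0n// mulrC.
  by rewrite ler_pdivrMr ?ltr0n// mul1r ler_nat.
by exists a => //; rewrite scalerA.
Qed.

Theorem kappa_frechet_urysohn_quasibarrelled (R : realType) (K : numFieldType)
    (hK : real_or_complex R K) (E : tvsType K) :
  kappa_frechet_urysohn E -> quasibarrelled E.
Proof.
move=> [[_ hE] kE] A cA acA bA; apply: contrapT => A0.
have [y0 Ay0] := bornivorous_neq0 bA.
have [z zN0] : exists z : E, z != 0.
  apply: contrapT => E0; apply: A0; suff -> : A = setT by exact: filterT.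
  have all0 (y : E) : y = 0.
    by apply/eqP; apply: contrapT => /negP y0'; apply: E0; exists y.
  by apply/seteqP; split => // y _; rewrite (all0 y) -(all0 y0).
have n0 n : (n.+1%:R^-1 : K) != 0 by rewrite invr_eq0 pnatr_eq0.
pose z_ n := n.+1%:R^-1 *: z.
have [|P [Q PQ]] := @hausdorff_separate_seq0 E 0 z_ hE.
  by move=> n; rewrite scaler_eq0 negb_or n0.
pose U := \bigcup_n (P n `&` [set y | ~ A (n.+1%:R^-1 *: y)]).
have oU : open U.
  apply: bigcup_open => n _; apply: openI; first by have [] := PQ n.
  exact: closed_scale_openC.
have U0 : closure U 0.
  (* Near a point of the interior of [O], the set [O] can be cut by [P n]. *)
  move=> O /nbhs_interior O0; have /nbhs_ballP[e /= e0 eO] := near0_scale z O0.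
  have [n ne] := real_or_complex_invn_lt hK e0.
  have [oP Pz _ _] := PQ n.
  have zO : nbhs (z_ n) O.
    by apply: eO; rewrite -ball_normE /ball_ /= sub0r normrN gtr0_norm.
  have zOP : nbhs (z_ n) (O `&` P n).
    by apply: filterI => //; exact: open_nbhs_nbhs.
  have [y [Oy Py] nAy] := nbhs_scale_notin (n0 n) acA A0 zOP.
  by exists y; split => //; exists n.
have [u [Uu u0]] := kE U 0 oU U0.
have [m um] := bA _ (tvs_bounded_cvg_seq u0).
have [N _ NQ] : \forall k \near \oo, forall i : 'I_m, Q i (u k).
  apply: (@filter_forall _ _ (fun i : 'I_m => [set k | Q i (u k)])) => i.
  by apply: u0; have [] := PQ i.
have [n _ [Pu nAu]] := Uu N.
have [nm|mn] := ltnP n m.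
  have [_ _ _ PQ0] := PQ n.
  suff: set0 (u N) by [].
  by rewrite -PQ0; split => //; exact: (NQ N (leqnn N) (Ordinal nm)).
have [a Aa au] : ( *:%R m%:R @` A) (u N) by apply: um; exists N.
by apply: nAu; rewrite -au; apply: balanced_scale_le (leqW mn) Aa; case: acA.
Qed.

Theorem theorem5p1 (R : realType) (K : numFieldType)
    (hK : real_or_complex R K) (E : tvsType K) (hE : kappa_frechet_urysohn E) :
  b_baire_like E /\ quasibarrelled E.
Proof.
have qE := kappa_frechet_urysohn_quasibarrelled hK hE.
by split => // A _ AP _; exists 0%N; have [cA acA bA] := AP 0%N; exact: qE.
Qed.
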